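(* Let $G$ be a $k$-out directed graph. Then $G$ is not lumpable if and only if $G$ is totally simple.
   Context: A graph is a finite directed multigraph $G=(V,E,s,t)$ with source and target maps $s,t:E\to V$ (loops and parallel edges allowed). It is $k$-out if every vertex has exactly $k$ outgoing edges. A partition $\{C_1,\dots,C_m\}$ of $V$ is lumpable if for all $i,j$ and all $u,u'\in C_i$, the number of edges from $u$ to vertices of $C_j$ equals the number of edges from $u'$ to vertices of $C_j$. The graph $G$ is called lumpable if it admits a nontrivial lumpable partition, i.e. a lumpable partition different from the discrete partition (all blocks singletons) and from the one-block partition $\{V\}$. A coloring of $G$ is a map $\chi:E\to[k]=\{1,\dots,k\}$ whose restriction to the set of outgoing edges of each vertex is a bijection onto $[k]$. It defines the deterministic complete automaton $\chi(G)=(V,[k],\delta_\chi)$, where $\delta_\chi(v,a)=t(e)$ for the unique edge $e$ with $s(e)=v$, $\chi(e)=a$. A congruence of an automaton $(Q,\Sigma,\delta)$ is an equivalence relation $\rho$ on $Q$ such that $p\,\rho\,q$ implies $\delta(p,a)\,\rho\,\delta(q,a)$ for all $a\in\Sigma$. An automaton is simple if its only congruences are the discrete (identity) and the universal one. $G$ is totally simple if $\chi(G)$ is simple for every coloring $\chi$ of $G$. *)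

(* Defs.v *)
From mathcomp Require Import all_boot.

Set Implicit Arguments.
Unset Strict Implicit.
Unset Printing Implicit Defensive.

Record digraph := Digraph {
  vertex : finType;
  edge : finType;
  src : edge -> vertex;
  tgt : edge -> vertex }.

Definition out_edges (G : digraph) (v : vertex G) : {set edge G} :=
  [set e | src e == v].

Definition k_out (k : nat) (G : digraph) : Prop :=
  forall v : vertex G, #|out_edges v| = k.

Definition lumpable_partition (G : digraph) (P : {set {set vertex G}}) : Prop :=
  partition P [set: vertex G] /\
  forall C D : {set vertex G}, C \in P -> D \in P ->
  forall u u' : vertex G, u \in C -> u' \in C ->
  #|[set e in out_edges u | tgt e \in D]| =
  #|[set e in out_edges u' | tgt e \in D]|.

Definition lumpable (G : digraph) : Prop :=
  exists P : {set {set vertex G}},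
    [/\ lumpable_partition P,
        P <> [set [set v] | v : vertex G] &
        P <> [set [set: vertex G]]].

(* The palette [k] = {1, ..., k} is represented by 'I_k. *)
Definition is_coloring (k : nat) (G : digraph) (chi : edge G -> 'I_k) : Prop :=
  forall v : vertex G,
    {in out_edges v &, injective chi} /\ chi @: out_edges v = [set: 'I_k].

Record coloring (k : nat) (G : digraph) := Coloring {
  color :> edge G -> 'I_k;
  coloringP : is_coloring color }.

Lemma colored_edge_exists k (G : digraph) (chi : coloring k G)
    (v : vertex G) (a : 'I_k) :
  exists e : edge G, (src e == v) && (chi e == a).
Proof.
have [_ /setP/(_ a)] := coloringP chi v.
rewrite inE => /imsetP[e]; rewrite inE => se ->.
by exists e; rewrite se eqxx.
Qed.

(* The edge chosen here is the only one: see [colored_edge_unique]. *)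
Definition colored_edge k (G : digraph) (chi : coloring k G)
    (v : vertex G) (a : 'I_k) : edge G :=
  xchoose (colored_edge_exists chi v a).

Lemma colored_edge_unique k (G : digraph) (chi : coloring k G)
    (v : vertex G) (a : 'I_k) (e : edge G) :
  src e = v -> chi e = a -> e = colored_edge chi v a.
Proof.
move=> se ce; have /andP[sf /eqP cf] := xchooseP (colored_edge_exists chi v a).
have [inj _] := coloringP chi v.
apply: inj; rewrite ?inE ?se //.
exact: etrans ce (esym cf).
Qed.

Record automaton := Automaton {
  state : finType;
  letter : finType;
  delta : state -> letter -> state }.

Definition automaton_of k (G : digraph) (chi : coloring k G) : automaton :=
  @Automaton (vertex G) 'I_k (fun v a => tgt (colored_edge chi v a)).

Definition congruence (A : automaton) (rho : rel (state A)) : Prop :=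
  equivalence_rel rho /\
  forall (p q : state A) (a : letter A),
    rho p q -> rho (delta p a) (delta q a).

Definition simple (A : automaton) : Prop :=
  forall rho : rel (state A), congruence rho ->
    (forall p q, rho p q = (p == q)) \/ (forall p q, rho p q).

Definition totally_simple (k : nat) (G : digraph) : Prop :=
  forall chi : coloring k G, simple (automaton_of chi).

(* Main.v *)
Require Import Defs.
From mathcomp Require Import all_boot.

(** The classes of a congruence of a coloring form a lumpable partition:
    related vertices send equally colored edges into the same class.
    Conversely, given a lumpable partition, sort the out-edges of each vertex by
    the block of their target and color every edge by its position. Lumpability
    forces any two vertices of a block to have the same sorted list of target
    blocks, so the partition becomes a congruence of this coloring. *)

Section EquivalencePartition.

Variables (T : finType) (R : rel T).
Hypothesis eqR : equivalence_rel R.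

Lemma equivalence_rel_right x y z : R x y -> R z x = R z y.
Proof.
have /equivalence_relP[Rxx Rtr] := eqR.
have Rsym a b : R a b -> R b a by move/Rtr <-.
by move=> /Rtr Rxy; apply/idP/idP => /Rsym Rz; apply: Rsym; rewrite ?Rxy // -Rxy.
Qed.

Lemma equivalence_partitionT_partition :
  partition (equivalence_partition R [set: T]) [set: T].
Proof. by apply: equivalence_partitionP => x y z _ _ _; apply: eqR. Qed.

Lemma equivalence_partition_discrete :
  equivalence_partition R [set: T] = [set [set v] | v : T] <->
  forall x y, R x y = (x == y).
Proof.
split=> [defP x y | defR].
  have Rxx z : R z z by case: (eqR z z z).
  have : [set z in [set: T] | R x z] \in equivalence_partition R [set: T].
    by apply: imset_f; rewrite inE.
  rewrite defP => /imsetP[v _ /setP defv].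
  (* The class of [x] is the singleton of [v]; since it contains [x], [v] must be [x]. *)
  have := defv x; have := defv y; rewrite !inE Rxx /= => -> /esym/eqP->.
  by rewrite eq_sym.
have class1 x : [set y in [set: T] | R x y] = [set x].
  by apply/setP=> y; rewrite !inE defR eq_sym.
by apply/setP=> C; apply/imsetP/imsetP=> -[x _ ->]; exists x; rewrite ?class1.
Qed.

(* [x0] is needed: on the empty type the partition is empty, not [set setT]. *)
Lemma equivalence_partition_universal (x0 : T) :
  equivalence_partition R [set: T] = [set [set: T]] <->
  forall x y, R x y.
Proof.
split=> [defP x y | allR].
  have : [set z in [set: T] | R x z] \in equivalence_partition R [set: T].
    by apply: imset_f; rewrite inE.
  by rewrite defP inE => /eqP/setP/(_ y); rewrite !inE.
have classT x : [set y in [set: T] | R x y] = [set: T].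
  by apply/setP=> y; rewrite !inE allR.
apply/setP=> C; rewrite inE; apply/imsetP/eqP=> [[x _ ->] // | ->].
by exists x0; rewrite ?inE ?classT.
Qed.

End EquivalencePartition.

Section ColoredEdge.

Variables (k : nat) (G : digraph) (chi : coloring k G).

Lemma src_colored_edge v a : src (colored_edge chi v a) = v.
Proof. by have /andP[/eqP] := xchooseP (colored_edge_exists chi v a). Qed.

Lemma color_colored_edge v a : chi (colored_edge chi v a) = a.
Proof. by have /andP[_ /eqP] := xchooseP (colored_edge_exists chi v a). Qed.

(** At a fixed vertex, [colored_edge] is a bijection from colors to out-edges, so edges can be
    counted by their colors, which are comparable across vertices. *)
Lemma card_out_edges_colored v (D : {set vertex G}) :
  #|[set e in out_edges v | tgt e \in D]| =
  #|[set a | tgt (colored_edge chi v a) \in D]|.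
Proof.
rewrite -(card_imset _ (can_inj (color_colored_edge v))).
apply: eq_card => e; rewrite !inE; apply/andP/imsetP=> [[/eqP se De] | [a]].
  by exists (chi e); rewrite ?inE -(colored_edge_unique se).
by rewrite inE => Da ->; rewrite src_colored_edge.
Qed.

Lemma congruence_lumpable (rho : rel (vertex G)) :
  @congruence (automaton_of chi) rho ->
  lumpable_partition (equivalence_partition rho [set: vertex G]).
Proof.
case=> eqrho congr; split; first exact: equivalence_partitionT_partition.
move=> _ _ /imsetP[x _ ->] /imsetP[z _ ->] u u'; rewrite !inE /= => xu xu'.
have uu' : rho u u' by have [_ <-] := eqrho x u u'.
(* Not only the cardinals but the color sets agree: for each [a] the two [a]-successors are related,
   hence both or neither lie in the class of [z]. *)
rewrite !card_out_edges_colored; apply: eq_card => a; rewrite !inE /=.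
exact: (@equivalence_rel_right (vertex G) rho eqrho _ _ z (congr u u' a uu')).
Qed.

End ColoredEdge.

Section SortedColoring.

Variables (k : nat) (G : digraph) (P : {set {set vertex G}}).
Hypothesis hG : k_out k G.

Definition target_block (e : edge G) : {set vertex G} := pblock P (tgt e).

(** An arbitrary linear order on vertex sets; injectivity of [enum_rank] gives the antisymmetry that
    makes sorted lists of blocks unique. *)
Definition block_le (C D : {set vertex G}) : bool := enum_rank C <= enum_rank D.

Definition sorted_out (v : vertex G) : seq (edge G) :=
  sort (relpre target_block block_le) (enum (out_edges v)).

Lemma mem_sorted_out v e : (e \in sorted_out v) = (src e == v).
Proof. by rewrite mem_sort mem_enum inE. Qed.

Lemma sorted_out_uniq v : uniq (sorted_out v).
Proof. by rewrite sort_uniq enum_uniq. Qed.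

Lemma size_sorted_out v : size (sorted_out v) = k.
Proof. by rewrite size_sort -cardE hG. Qed.

Lemma sorted_color_subproof e : index e (sorted_out (src e)) < k.
Proof.
rewrite -[X in _ < X](size_sorted_out (src e)).
by rewrite index_mem mem_sorted_out.
Qed.

Definition sorted_color (e : edge G) : 'I_k := Ordinal (sorted_color_subproof e).

Lemma sorted_colorP : is_coloring sorted_color.
Proof.
move=> v; split=> [e f | ].
  rewrite !inE => /eqP se /eqP sf /(congr1 val) /=; rewrite se sf => eq_ix.
  have ev : e \in sorted_out v by rewrite mem_sorted_out se.
  have fv : f \in sorted_out v by rewrite mem_sorted_out sf.
  by rewrite -(nth_index e ev) eq_ix nth_index.
apply/setP=> a; rewrite inE; apply/imsetP.
have lt_a : a < size (sorted_out v) by rewrite size_sorted_out.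
(* [nth] needs a default edge; one exists because the list has a position [a]. *)
have [e0 _] : exists e0 : edge G, true.
  by case: (sorted_out v) lt_a => // e0; exists e0.
have := mem_nth e0 lt_a; rewrite mem_sorted_out => /eqP s_a.
exists (nth e0 (sorted_out v) a); first by rewrite inE s_a.
by apply: val_inj; rewrite /= s_a index_uniq ?sorted_out_uniq.
Qed.

Definition sorted_coloring : coloring k G := Coloring sorted_colorP.

Lemma colored_edge_sorted e0 v a :
  colored_edge sorted_coloring v a = nth e0 (sorted_out v) a.
Proof.
have lt_a : a < size (sorted_out v) by rewrite size_sorted_out.
have := mem_nth e0 lt_a; rewrite mem_sorted_out => /eqP s_a.
apply/esym/colored_edge_unique => //.
by apply: val_inj; rewrite /= s_a index_uniq ?sorted_out_uniq.
Qed.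

Hypothesis lumpP : lumpable_partition P.

Lemma mem_target_block D e : D \in P -> (target_block e == D) = (tgt e \in D).
Proof.
case: lumpP => /and3P[/eqP covP trivP _] _ PD.
apply/eqP/idP=> [<- | eD]; first by rewrite mem_pblock covP inE.
exact: def_pblock.
Qed.

(** Sorted lists with equal multiplicities coincide, and the multiplicity of a block is the edge
    count that lumpability equates. *)
Lemma target_blocks_eq u u' : pblock P u = pblock P u' ->
  map target_block (sorted_out u) = map target_block (sorted_out u').
Proof.
move=> eq_u; have [/and3P[/eqP covP _ _] eq_card_out] := lumpP.
have inP v : pblock P v \in P by rewrite pblock_mem ?covP ?inE.
have inblock v : v \in pblock P v by rewrite mem_pblock covP inE.
apply: (@sorted_eq _ block_le).
- by move=> C D E; apply: leq_trans.
- by move=> C D /anti_leq/val_inj/enum_rank_inj.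
- rewrite sorted_map sort_sorted // => e f; exact: leq_total.
- rewrite sorted_map sort_sorted // => e f; exact: leq_total.
have countE v D : count_mem D (map target_block (sorted_out v)) =
    #|[set e in out_edges v | target_block e == D]|.
  rewrite count_map count_sort -size_filter cardE; apply/perm_size/uniq_perm.
  - by rewrite filter_uniq ?enum_uniq.
  - exact: enum_uniq.
  by move=> e; rewrite mem_filter !mem_enum !inE andbC.
rewrite /perm_eq; apply/allP => D _; rewrite /= !countE; apply/eqP.
(* Lumpability only covers [D] in [P]; any other [D] is never a target block, so both counts are
   zero. *)
have [PD | notPD] := boolP (D \in P).
  have blockE v : [set e in out_edges v | target_block e == D] =
                  [set e in out_edges v | tgt e \in D].
    by apply/setP=> e; rewrite !inE mem_target_block.
  rewrite !blockE; apply: (eq_card_out _ _ (inP u) PD) => //.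
  by rewrite eq_u.
have noblock v : [set e in out_edges v | target_block e == D] = set0.
  apply/setP=> e; rewrite !inE; apply/negbTE/nandP; right.
  by apply: contraNneq notPD => <-; apply: inP.
by rewrite !noblock.
Qed.

Lemma sorted_congruence :
  @congruence (automaton_of sorted_coloring)
    (fun u v => pblock P u == pblock P v).
Proof.
split=> [x y z | u v a]; first by split=> // /eqP->.
move=> /eqP eq_uv; have e0 := colored_edge sorted_coloring u a.
(* The [a]-th entries are the blocks of the [a]-successors; the defaults [set0] and [e0] are never
   reached, as [a] is below [k]. *)
have := congr1 (fun s => nth set0 s a) (target_blocks_eq _ _ eq_uv).
rewrite !(nth_map e0) ?size_sorted_out // /target_block /= => eq_a.
by rewrite !(colored_edge_sorted e0) eq_a.
Qed.

End SortedColoring.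

Theorem theorem4p4 (k : nat) (G : digraph) (hG : k_out k G) :
  ~ lumpable G <-> totally_simple k G.
Proof.
split=> [nlump chi rho cong_rho | simpleG [P [lumpP nondiscrete not_one_block]]].
  have [eqrho _] := cong_rho.
  have lumpP := congruence_lumpable _ _ _ _ cong_rho.
  set P := equivalence_partition rho [set: vertex G] in lumpP.
  have [discrete | nondiscrete] := eqVneq P [set [set v] | v : vertex G].
    by left; apply/(@equivalence_partition_discrete _ rho eqrho).
  have [one_block | not_one_block] := eqVneq P [set [set: vertex G]].
    (* The vertex [p] itself witnesses that the graph is nonempty. *)
    by right=> p; case: (@equivalence_partition_universal _ rho p) => + _; apply.
  by case: nlump; exists P; split=> //; apply/eqP.
set rho : rel (vertex G) := fun u v => pblock P u == pblock P v.
have cong_rho := sorted_congruence _ _ _ hG lumpP.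
have eqrho : equivalence_rel rho by case: cong_rho.
(* A partition is recovered from the relation of lying in the same block. *)
have defP : equivalence_partition rho [set: vertex G] = P.
  by case: lumpP => partP _; apply: preim_partition_pblock partP.
case: (simpleG _ _ cong_rho) => [discrete | universal].
  by apply: nondiscrete; rewrite -defP; apply/equivalence_partition_discrete.
(* On an empty vertex set the universal relation is also the identity, so that case contradicts
   [nondiscrete] instead. *)
have [v _ | noV] := pickP (fun _ : vertex G => true).
  apply: not_one_block; rewrite -defP.
  exact/(@equivalence_partition_universal _ rho v).
apply: nondiscrete; rewrite -defP; apply/equivalence_partition_discrete => // x.
by have := noV x.
Qed.
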